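(* Let $Q=(q_n)_{n\ge1}$ be a basic sequence that is infinite in limit and satisfies $$\lim_{n\to\infty}\frac{\log q_n}{\sum_{i=1}^n\log q_i}=0.$$ Let $S$ be a non-empty set of non-negative integers such that $\min S<\min_{n\ge1} q_n$ and such that the mass dimension $\dim_{\mathrm M}(S)$ exists. Then $$\dim_{\mathrm H}\left(\mathscr{W}_Q(S)\right)=\dim_{\mathrm M}(S).$$
   Context: A basic sequence is a sequence $Q=(q_n)_{n=1}^\infty$ of integers with $q_n\ge 2$ for all $n$. It is infinite in limit if $q_n\to\infty$. The $Q$-Cantor series expansion of a real number $x$ is the unique expansion $x=E_0+\sum_{n=1}^\infty \frac{E_n}{q_1q_2\cdots q_n}$ with $E_0=\lfloor x\rfloor$, $E_n\in\{0,1,\ldots,q_n-1\}$ for $n\ge1$, and $E_n\ne q_n-1$ for infinitely many $n$. For such $x$ put $\mathscr{S}_Q(x)=\{E_1,E_2,E_3,\ldots\}$ (the set of digits that occur). For a non-empty set $S$ of non-negative integers, $\mathscr{W}_Q(S)=\{x\in\mathbb{R}:\mathscr{S}_Q(x)=S\}$. For $S\subseteq\mathbb{Z}$, the mass dimension of $S$ is $\dim_{\mathrm M}(S)=\lim_{n\to\infty}\frac{\log \#(S\cap(-n/2,n/2))}{\log n}$, if this limit exists. $\dim_{\mathrm H}$ denotes Hausdorff dimension of subsets of $\mathbb{R}$. *)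

(* Defs.v *)
From HB Require Import structures.
From mathcomp Require Import all_boot all_order all_algebra.
From mathcomp Require Import finmap.
From mathcomp Require Import all_classical all_reals all_analysis.

Set Implicit Arguments.
Unset Strict Implicit.
Unset Printing Implicit Defensive.

Import Order.TTheory GRing.Theory Num.Theory.
Import numFieldNormedType.Exports.

Local Open Scope classical_set_scope.
Local Open Scope ring_scope.

(* Sequences [q] and [E] are indexed as in q_1, q_2, ... and E_0, E_1, ...:
   the value [q 0] is never used. *)
Definition basic_sequence (q : nat -> int) : Prop :=
  forall n, (1 <= n)%N -> 2 <= q n.

Definition infinite_in_limit (R : realType) (q : nat -> int) : Prop :=
  (q n)%:~R @[n --> \oo] --> (+oo : set_system R).

Definition cantor_partial_sum (R : realType) (q E : nat -> int) (n : nat) : R :=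
  (E 0%N)%:~R +
  \sum_(1 <= k < n.+1) (E k)%:~R / \prod_(1 <= j < k.+1) (q j)%:~R.

Record cantor_expansion (R : realType) (q : nat -> int) (x : R)
    (E : nat -> int) : Prop := {
  cantor_int_part : E 0%N = Num.floor x;
  cantor_digit_range : forall n, (1 <= n)%N -> 0 <= E n <= q n - 1;
  cantor_digit_nonmax : forall N, exists2 n, (N < n)%N & E n != q n - 1;
  cantor_sum : cantor_partial_sum R q E n @[n --> \oo] --> x
}.

(* For a basic sequence [q], every [x] has exactly one expansion [E], so this
   is the set of the digits E_1, E_2, ... of that expansion. *)
Definition cantor_digits (R : realType) (q : nat -> int) (x : R) : set int :=
  [set s | exists E n, [/\ cantor_expansion q x E, (1 <= n)%N & E n = s]].

Definition prescribed_digits (R : realType) (q : nat -> int) (S : set int) :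
    set R :=
  [set x | cantor_digits q x = S].

Definition is_min (A : set int) (m : int) : Prop := A m /\ lbound A m.

(* The intersection is finite, so [fset_set] does enumerate it. *)
Definition mass_ratio (R : realType) (S : set int) (n : nat) : R :=
  ln (#|` fset_set (S `&` [set k : int |
            - (n%:R / 2) < (k%:~R : R) < n%:R / 2]) |%fset%:R)
  / ln n%:R.

Definition mass_dim_exists (R : realType) (S : set int) : Prop :=
  cvgn (mass_ratio R S).

Definition mass_dim (R : realType) (S : set int) : R :=
  limn (mass_ratio R S).

Section Hausdorff.
Context {R : realType}.
Local Open Scope ereal_scope.
Implicit Types (A U : set R) (s delta : R).

(* The value 0 is added because [ereal_sup set0 = -oo]. *)
Definition diam U : \bar R :=
  ereal_sup (0 |` [set `|x.1 - x.2|%:E | x in U `*` U]).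

(* The empty set has weight 0 for every [s]; a singleton has weight 1 for
   [s = 0], since [0 `^ 0 = 1]. *)
Definition diam_pow s U : \bar R := if U == set0 then 0 else diam U `^ s.

Definition delta_cover delta A : set (nat -> set R) :=
  [set U | A `<=` \bigcup_i U i /\ forall i, diam (U i) <= delta%:E].

Definition hausdorff_premeasure s delta A : \bar R :=
  ereal_inf [set \sum_(0 <= i <oo) diam_pow s (U i) | U in delta_cover delta A].

(* The premeasure is nonincreasing in [delta], so the limit as delta tends to
   0 is the supremum. *)
Definition hausdorff_measure s A : \bar R :=
  ereal_sup [set hausdorff_premeasure s delta A | delta in [set d | (0 < d)%R]].

Definition hausdorff_dim A : \bar R :=
  ereal_inf [set s%:E | s in [set s | (0 <= s)%R /\ hausdorff_measure s A = 0]].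

End Hausdorff.

(* Main.v *)
(* Upper bound: for s > d = dim_M(S) the points of W_Q(S) with a given integer
   part lie in the intervals [x, x + 1/P_n], P_n = q_1 ... q_n, where x runs over
   the n-th partial sums with digits in S.  Their number is O(P_n^t) for any
   t > d, so the s-dimensional weight of this cover tends to 0.

   Lower bound: for s < d choose finite digit sets A_n of S such that one-element
   sets force every element of S to occur, while the other A_n are all of
   S below q_n - 1.  Reading t in [0, 1[ in the mixed base (#A_n) and replacing
   each digit by the element of A_n of that rank gives a map g into W_Q(S).  The
   growth condition on Q makes the inverse of g s-Hoelder, so that covers of
   W_Q(S) pull back to covers of [0, 1[, whose Lebesgue measure is 1. *)

Require Import Defs.
From mathcomp Require Import lra zify.
From HB Require Import structures.
From mathcomp Require Import all_boot all_order all_algebra.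
From mathcomp Require Import finmap.
From mathcomp Require Import all_classical all_reals all_analysis.

Set Implicit Arguments.
Unset Strict Implicit.
Unset Printing Implicit Defensive.

Import Order.TTheory GRing.Theory Num.Theory.
Import numFieldNormedType.Exports.

Local Open Scope classical_set_scope.
Local Open Scope ring_scope.

(** * Cantor series expansions *)

Definition base_prod (R : realType) (q : nat -> int) (n : nat) : R :=
  \prod_(1 <= j < n.+1) (q j)%:~R.

Definition digits_in_range (q E : nat -> int) : Prop :=
  forall n, (1 <= n)%N -> 0 <= E n <= q n - 1.

Section CantorSeries.
Context {R : realType}.
Implicit Types (q E F : nat -> int) (x y : R).

Local Notation psum := (cantor_partial_sum R).
Local Notation P := (base_prod R).

Lemma base_prod0 q : P q 0 = 1.
Proof. by rewrite /base_prod big_geq. Qed.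

Lemma base_prodS q n : P q n.+1 = P q n * (q n.+1)%:~R.
Proof. by rewrite /base_prod big_nat_recr. Qed.

Lemma cantor_partial_sum0 q E : psum q E 0 = (E 0%N)%:~R.
Proof. by rewrite /cantor_partial_sum big_geq// addr0. Qed.

Lemma cantor_partial_sumS q E n :
  psum q E n.+1 = psum q E n + (E n.+1)%:~R / P q n.+1.
Proof. by rewrite /cantor_partial_sum big_nat_recr//= addrA. Qed.

Lemma basic_ge2 q n : basic_sequence q -> 2 <= (q n.+1)%:~R :> R.
Proof. by move=> qb; rewrite -[2]/(2%:~R) ler_int; exact: qb. Qed.

Lemma base_prod_gt0 q n : basic_sequence q -> 0 < P q n.
Proof.
move=> qb; elim: n => [|n IH]; first by rewrite base_prod0.
by rewrite base_prodS mulr_gt0// (lt_le_trans _ (basic_ge2 n qb)).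
Qed.

Lemma base_prodVS q n : basic_sequence q ->
  (P q n)^-1 = (q n.+1)%:~R / P q n.+1.
Proof.
move=> qb; rewrite base_prodS invfM mulrCA divff ?mulr1//.
by have := basic_ge2 n qb; lra.
Qed.

Lemma cantor_partial_sum_nd q E m n : basic_sequence q ->
  digits_in_range q E -> (m <= n)%N -> psum q E m <= psum q E n.
Proof.
move=> qb Er /subnK <-; elim: (n - m)%N => [//|k /le_trans IH].
rewrite addSn; apply: IH; rewrite cantor_partial_sumS lerDl divr_ge0//.
- by rewrite ler0z; have /andP[] := Er (k + m).+1 isT.
- exact/ltW/base_prod_gt0.
Qed.

(** Used with [c = 1] for an arbitrary digit and [c = 2] for a non-maximal one. Since [(P q n)^-1]
    consists of [q n.+1] units [(P q n.+1)^-1], the bounds for successive digits telescope. *)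
Lemma cantor_digit_le q E n c : basic_sequence q -> E n.+1 <= q n.+1 - c ->
  (E n.+1)%:~R / P q n.+1 <= (P q n)^-1 - c%:~R / P q n.+1.
Proof.
move=> qb Ec; rewrite (base_prodVS n qb) -mulrBl ler_wpM2r//.
  by rewrite invr_ge0 ltW// base_prod_gt0.
by rewrite -rmorphB ler_int.
Qed.

Lemma cantor_partial_sum_le q E m n : basic_sequence q ->
  digits_in_range q E -> (m <= n)%N ->
  psum q E n <= psum q E m + (P q m)^-1 - (P q n)^-1.
Proof.
move=> qb Er /subnK <-; elim: (n - m)%N => [|k IH]; first by rewrite addrK.
have /andP[_ Ek] := Er (k + m).+1 isT.
have := @cantor_digit_le q E (k + m) 1 qb Ek.
rewrite addSn cantor_partial_sumS mulr1z mul1r.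
by lra.
Qed.

Section Sum.
Variables (q E : nat -> int) (x : R).
Hypothesis qb : basic_sequence q.
Hypothesis Er : digits_in_range q E.
Hypothesis Ex : psum q E n @[n --> \oo] --> x.

Lemma cantor_sum_ge n : psum q E n <= x.
Proof.
apply: (ler_cvg_to (cvg_cst _) Ex); near=> m.
by apply: cantor_partial_sum_nd => //; near: m; exact: nbhs_infty_ge.
Unshelve. all: by end_near. Qed.

Lemma cantor_sum_le n : x <= psum q E n + (P q n)^-1.
Proof.
apply: (ler_cvg_to Ex (cvg_cst _)); near=> m.
apply: le_trans (@cantor_partial_sum_le q E n m qb Er _) _.
  by near: m; exact: nbhs_infty_ge.
by rewrite lerBlDr lerDl invr_ge0 ltW// base_prod_gt0.
Unshelve. all: by end_near. Qed.

(** A non-maximal digit at [m] saves one more unit [(P q m)^-1] over the telescoped bound. *)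
Lemma cantor_sum_lt n m : (n < m)%N -> E m != q m - 1 ->
  x <= psum q E n + (P q n)^-1 - (P q m)^-1.
Proof.
case: m => // m; rewrite ltnS => nm Em.
have /andP[_ Em1] := Er (ltn0Sn m).
have Em2 : E m.+1 <= q m.+1 - 2 by move/eqP: Em Em1; lia.
have := @cantor_digit_le q E m 2 qb Em2.
have := cantor_sum_le m.+1; have := cantor_partial_sum_le qb Er nm.
rewrite cantor_partial_sumS.
by lra.
Qed.

End Sum.

Lemma eq_cantor_partial_sum q E F n :
  (forall i, (i <= n)%N -> E i = F i) -> psum q E n = psum q F n.
Proof.
elim: n => [|n IH] EF; first by rewrite !cantor_partial_sum0 EF.
by rewrite !cantor_partial_sumS IH ?EF// => i /leqW; exact: EF.
Qed.

(* A non-maximal digit of [F] at m > n keeps y away from the right endpoint of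
   its cylinder of rank n; x = y gives the uniqueness of expansions, m = n + 1
   the separation of points. *)
Lemma cantor_separation q E F x y n m : basic_sequence q ->
  digits_in_range q E -> digits_in_range q F ->
  psum q E k @[k --> \oo] --> x -> psum q F k @[k --> \oo] --> y ->
  (forall i, (i < n)%N -> E i = F i) -> F n < E n ->
  (n < m)%N -> F m != q m - 1 -> (P q m)^-1 <= x - y.
Proof.
move=> qb Er Fr Ex Fy EF FEn nm Fm.
have := cantor_sum_lt qb Fr Fy nm Fm; have := cantor_sum_ge qb Er Ex n.
suff : psum q F n + (P q n)^-1 <= psum q E n by lra.
have FE1 : (F n)%:~R + 1 <= (E n)%:~R :> R by rewrite -intrD1 ler_int lezD1.
case: n EF FEn nm FE1 => [|n] EF FEn nm FE1.
  by rewrite !cantor_partial_sum0 base_prod0 invr1.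
rewrite !cantor_partial_sumS (@eq_cantor_partial_sum q E F n); last first.
  by move=> i; rewrite -ltnS => /EF.
rewrite -addrA lerD2l -{2}[(P q n.+1)^-1]mul1r -mulrDl ler_wpM2r//.
by rewrite invr_ge0 ltW// base_prod_gt0.
Qed.

Lemma cantor_expansion_range q E x : cantor_expansion q x E ->
  digits_in_range q E.
Proof. by case. Qed.

Lemma cantor_expansion_unique q E F x : basic_sequence q ->
  cantor_expansion q x E -> cantor_expansion q x F -> E =1 F.
Proof.
move=> qb cE cF; apply: contrapT => /existsNP[i /eqP EFi].
have /ex_minnP[n EFn nmin] : exists i, E i != F i by exists i.
have {nmin}EF k : (k < n)%N -> E k = F k.
  by rewrite ltnNge => kn; apply/eqP; apply: contraNT kn => /nmin.
have sep E' F' : cantor_expansion q x E' -> cantor_expansion q x F' ->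
    (forall k, (k < n)%N -> E' k = F' k) -> F' n < E' n -> False.
  move=> cE' cF' EF' FEn; have [m nm Fm] := cantor_digit_nonmax cF' n.
  have := cantor_separation qb (cantor_expansion_range cE')
    (cantor_expansion_range cF') (cantor_sum cE') (cantor_sum cF') EF' FEn nm Fm.
  by rewrite subrr leNgt invr_gt0 base_prod_gt0.
have := EFn; rewrite neq_lt => /orP[lt|lt]; last exact: sep lt.
by apply: sep lt => // k /EF.
Qed.

Lemma cantor_partial_sum_cvg q E : basic_sequence q -> digits_in_range q E ->
  cvgn (psum q E).
Proof.
move=> qb Er; apply: nondecreasing_is_cvgn.
  by move=> m n; exact: cantor_partial_sum_nd.
exists (psum q E 0 + 1) => _ [n _ <-].
have := cantor_partial_sum_le qb Er (leq0n n).
by have := base_prod_gt0 n qb; rewrite -invr_gt0 base_prod0 invr1; lra.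
Qed.

Lemma cantor_expansion_limn q E : basic_sequence q -> digits_in_range q E ->
  (forall N, exists2 n, (N < n)%N & E n != q n - 1) ->
  cantor_expansion q (limn (psum q E)) E.
Proof.
move=> qb Er Enm; have Ex := cantor_partial_sum_cvg qb Er.
split=> //; apply/esym/floor_def.
(* The non-maximal digit at [m] keeps the limit strictly below [E 0 + 1], so its floor is [E 0]. *)
have := cantor_sum_ge qb Er Ex 0; have [m m0 Em] := Enm 0%N.
have := cantor_sum_lt qb Er Ex m0 Em.
rewrite cantor_partial_sum0 base_prod0 invr1 rmorphD/=.
have : 0 < (P q m)^-1 by rewrite invr_gt0 base_prod_gt0.
by move=> *; apply/andP; split; lra.
Qed.

End CantorSeries.

(** * Criteria for Hausdorff measure *)

Lemma nneseries_pair (R : realType) (e : {bij [set: nat] >-> [set: nat * nat]})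
    (h : nat * nat -> \bar R) : (forall p, 0 <= h p)%E ->
  (\sum_(0 <= k <oo) h (e k) =
   \sum_(0 <= i <oo) \sum_(0 <= j <oo) h (i, j))%E.
Proof.
move=> h0; rewrite nneseries_esumT// -(@reindex_esum _ _ _ setT setT); last first.
  exact: bij.
have -> : [set: nat * nat] = [set: nat] `*`` (fun=> [set: nat]).
  by apply/seteqP; split.
have -> : h = fun p => h (p.1, p.2) by apply/funext => -[].
rewrite -(@esum_esum _ _ _ _ _ (fun i j => h (i, j)))//.
rewrite nneseries_esumT => [|i]; last exact: nneseries_ge0.
by apply: eq_esum => i _; rewrite nneseries_esumT.
Qed.

Section HausdorffBounds.
Context {R : realType}.
Implicit Types (A U : set R) (s r x y : R).
Local Open Scope ereal_scope.

Lemma diam_ge0 U : 0 <= diam U.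
Proof. by apply: ereal_sup_ubound; left. Qed.

Lemma dist_le_diam U x y : U x -> U y -> `|x - y|%:E <= diam U.
Proof. by move=> Ux Uy; apply: ereal_sup_ubound; right; exists (x, y). Qed.

Lemma diam_le U r : (0 <= r)%R ->
  (forall x y, U x -> U y -> (`|x - y| <= r)%R) -> diam U <= r%:E.
Proof.
move=> r0 Ur; apply: ge_ereal_sup => _ [->|[[x y] [/= Ux Uy] <-]].
  by rewrite lee_fin.
by rewrite lee_fin Ur.
Qed.

Lemma diam_pow_ge0 s U : 0 <= diam_pow s U.
Proof. by rewrite /diam_pow; case: ifP => // _; exact: poweR_ge0. Qed.

Lemma diam_pow_le s U r : (0 <= s)%R -> diam U <= r%:E ->
  diam_pow s U <= (r `^ s)%:E.
Proof.
move=> s0 Ur; rewrite /diam_pow; case: ifP => _.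
  by rewrite lee_fin powR_ge0.
rewrite -poweR_EFin gt0_ler_poweR// in_itv/= ?diam_ge0 ?leey//.
by rewrite (le_trans (diam_ge0 U) Ur).
Qed.

Lemma hausdorff_premeasure_ge0 s delta A : 0 <= hausdorff_premeasure s delta A.
Proof.
apply: le_ereal_inf_tmp => _ [U _ <-].
by apply: nneseries_ge0 => *; exact: diam_pow_ge0.
Qed.

(** Countable subadditivity is built in: the cover of [A i] gets the budget [eps / 2 ^ i.+1], and a
    bijection between [nat] and [nat * nat] merges all covers into one sequence. *)
Lemma hausdorff_measure_eq0 s (A : nat -> set R) : (0 <= s)%R ->
  (forall i delta eps, (0 < delta)%R -> (0 < eps)%R ->
    exists n (B : nat -> set R) r, [/\ (0 <= r <= delta)%R,
      forall j, diam (B j) <= r%:E, A i `<=` \bigcup_(j in `I_n) B j &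
      (n%:R * r `^ s <= eps)%R]) ->
  hausdorff_measure s (\bigcup_i A i) = 0.
Proof.
move=> s0 cov; apply/eqP; rewrite eq_le; apply/andP; split; last first.
  apply: (le_trans (hausdorff_premeasure_ge0 s 1 (\bigcup_i A i))).
  by apply: ereal_sup_ubound; exists 1%R => //=.
apply: ge_ereal_sup => _ [delta /= delta0 <-].
apply/lee_addgt0Pr => eps eps0; rewrite add0e.
pose ok i nB := (A i `<=` \bigcup_(j in `I_(nB.1)) nB.2 j /\
  exists r : R, [/\ (0 <= r <= delta)%R, forall j, diam (nB.2 j) <= r%:E &
  (nB.1%:R * r `^ s <= eps / (2 ^ i.+1)%:R)%R]).
have /choice[/= nB nBP] : forall i, exists nB : nat * (nat -> set R), ok i nB.
  move=> i; have [|n [B [r [rd Br An nr]]]] :=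
    cov i delta (eps / (2 ^ i.+1)%:R)%R delta0.
    by rewrite divr_gt0// ltr0n expn_gt0.
  by exists (n, B); split => //; exists r.
(* Padding by [set0] turns the finite covers into sequences; [diam_pow] gives it weight 0 even when
   [s = 0]. *)
pose G (p : nat * nat) := if (p.2 < (nB p.1).1)%N then (nB p.1).2 p.2 else set0.
have /card_esym/ppcard_eqP[f] := card_nat2.
apply: (@le_trans _ _ (\sum_(0 <= k <oo) diam_pow s (G (f k)))).
  apply: ereal_inf_lbound; exists (G \o f) => //; split.
    move=> x [i _ Ai]; have [/(_ _ Ai)[j /= jn Bx] _] := nBP i.
    exists (f^-1%FUN (i, j)) => //=.
    by rewrite invK ?inE// /G/= jn.
  move=> k /=; rewrite /G; case: ifP => _.
    have [_ [r [/andP[_ rd] /(_ (f k).2) Br _]]] := nBP (f k).1.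
    by rewrite (le_trans Br)// lee_fin.
  by apply: diam_le => //; exact: ltW.
rewrite (nneseries_pair f (h := fun p => diam_pow s (G p))); last first.
  by move=> p; exact: diam_pow_ge0.
have -> : eps%:E = \sum_(0 <= i <oo) (0 : \bar R) + eps%:E.
  by rewrite eseries0// add0e.
apply: le_trans (epsilon_trick xpredT _ _) => //; last exact: ltW.
apply: lee_nneseries => [i _ _|i _].
  by apply: nneseries_ge0 => *; exact: diam_pow_ge0.
rewrite add0e; have [_ [r [rd Br nr]]] := nBP i.
apply: lime_le.
  by apply: is_cvg_nneseries => *; exact: diam_pow_ge0.
near=> m; apply: (@le_trans _ _ ((minn m (nB i).1)%:R * r `^ s)%:E); last first.
  rewrite lee_fin (le_trans _ nr)// ler_wpM2r ?powR_ge0// ler_nat.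
  exact: geq_minr.
elim: (m) => [|k IH]; first by rewrite big_geq// min0n mul0r.
rewrite big_nat_recr//=; have [kn|kn] := ltnP k (nB i).1.
  rewrite (minn_idPl kn) -natr1 mulrDl mul1r EFinD leeD//.
    by rewrite (minn_idPl (ltnW kn)) in IH.
  by rewrite /G/= kn; exact: diam_pow_le.
rewrite /G/= [X in diam_pow s X]ifF; last by rewrite ltnNge kn.
rewrite {2}/diam_pow eqxx adde0 (minn_idPr (leqW kn)).
by rewrite (minn_idPr kn) in IH.
Unshelve. all: by end_near. Qed.

(* A map from [0, 1[ into A whose inverse is s-Hoelder transports Lebesgue
   measure: a cover of A by sets U_i pulls back to a cover of [0, 1[ by
   intervals of length 2 C (diam U_i)^s. *)
Lemma hausdorff_measure_neq0 s (A : set R) (g : R -> R) (C : R) : (0 <= s)%R ->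
  (0 <= C)%R -> (forall t, (0 <= t < 1)%R -> A (g t)) ->
  (forall t u, (0 <= t < 1)%R -> (0 <= u < 1)%R ->
    (`|t - u| <= C * `|g t - g u| `^ s)%R) ->
  hausdorff_measure s A != 0.
Proof.
move=> s0 C0 gA gC; apply/negP => /eqP mA.
have : hausdorff_premeasure s 1 A <= 0.
  by rewrite -mA; apply: ereal_sup_ubound; exists 1%R => //=.
(* [C] may be 0; the larger [C1] is positive, so [2 * C1] can be inverted. *)
have [C1 [C10 CC1]] : exists C1 : R, (0 < C1 /\ C <= C1)%R by exists (C + 1)%R; lra.
suff : (2 * C1)^-1%:E <= hausdorff_premeasure s 1 A.
  move=> /le_trans/[apply]; rewrite lee_fin leNgt invr_gt0 => /negP; apply; lra.
apply: le_ereal_inf_tmp => _ [U [AU U1] <-].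
have [d dU] : exists d : nat -> R, forall i, diam (U i) = (d i)%:E.
  exists (fun i => fine (diam (U i))) => i; rewrite fineK// fin_numElt.
  by rewrite (lt_le_trans _ (diam_ge0 (U i))) ?ltNy0//= (le_lt_trans (U1 i)) ?ltry.
pose J i : set R := [set t | (0 <= t < 1)%R /\ U i (g t)].
have /choice[I II] : forall i, exists I : interval R, J i `<=` [set` I] /\
    lebesgue_measure [set` I] <= (2 * C1)%:E * diam_pow s (U i).
  move=> i; have [->|/set0P[t [t01 Ut]]] := eqVneq (J i) set0.
    exists `]0%R, 0%R[; rewrite set_itvoo0; split => //.
    by rewrite measure0 mule_ge0 ?diam_pow_ge0// lee_fin; lra.
  (* Any point [t] of [J i] can serve as the centre: by the Hoelder bound the rest of [J i] lies
     within [r] of it. *)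
  pose r := (C1 * d i `^ s)%R; exists `[(t - r)%R, (t + r)%R]; split.
    move=> u [u01 Uu]; rewrite /= in_itv/= -ler_distl.
    apply: (le_trans (gC _ _ u01 t01)); rewrite /r ler_pM ?powR_ge0//.
    apply: ge0_ler_powR => //; rewrite ?nnegrE//; last first.
      by rewrite -lee_fin -dU; exact: dist_le_diam.
    by rewrite -lee_fin -dU diam_ge0.
  rewrite /diam_pow ifF; last by apply/negP => /eqP U0; rewrite U0 in Ut.
  rewrite dU poweR_EFin -EFinM lebesgue_measure_itv/= lte_fin.
  have r0 : (0 <= r)%R by rewrite mulr_ge0 ?powR_ge0// ltW.
  have rE : (2 * C1 * d i `^ s = 2 * r)%R by rewrite mulrA.
  by case: ifPn => _; rewrite ?lee_fin ?rE -?EFinD ?lee_fin; lra.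
have : lebesgue_measure `[0%R, 1%R[ <=
    \sum_(0 <= i <oo) lebesgue_measure [set` I i].
  apply: measure_sigma_subadditive => //.
  move=> t /=; rewrite in_itv/= => t01.
  have [i _ Ui] := AU _ (gA t t01).
  by exists i => //; apply: (II i).1; split.
rewrite lebesgue_measure_itv/= lte_fin ltr01 oppr0 adde0 => le1.
have {}le1 : 1 <= (2 * C1)%:E * \sum_(0 <= i <oo) diam_pow s (U i).
  rewrite -nneseriesZl; last by move=> *; exact: diam_pow_ge0.
  by apply: (le_trans le1); apply: lee_nneseries => // i _; exact: (II i).2.
rewrite -[leLHS]mule1 lee_pdivrMl//; lra.
Qed.

End HausdorffBounds.

(** * The upper bound *)

Definition digits_below (S : set int) (b : int) : {fset int} :=
  fset_set (S `&` [set k | 0 <= k < b]).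

Lemma powRV (R : realType) (u x : R) : 0 <= x -> x^-1 `^ u = (x `^ u)^-1.
Proof. by move=> x0; rewrite -powR_inv1// -powRrM mulN1r powRN. Qed.

(** * Digit counts from the mass dimension *)

Section Counting.
Context {R : realType}.
Variables (S : set int).
Hypothesis S0 : forall s, S s -> 0 <= s.
Hypothesis Sdim : mass_dim_exists R S.
Local Notation d := (mass_dim R S).

Lemma digits_belowP b k : k \in digits_below S b <-> S k /\ 0 <= k < b.
Proof.
have fin : finite_set (S `&` [set k | 0 <= k < b]).
  apply: (@sub_finite_set _ _ [set Posz i | i in `I_(`|b|%N)]).
    move=> i [_ /= ib]; exists `|i|%N => /=; last lia.
    by move: ib; lia.
  exact/finite_image/finite_II.
by rewrite /digits_below in_fset_set// inE.
Qed.

(** At the even index [b.*2] the window of the mass ratio is []-b, b[], and only its non-negative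
    half meets [S]. *)
Lemma mass_ratio_double (b : nat) :
  mass_ratio R S b.*2 = ln (#|` digits_below S b|%:R) / ln b.*2%:R.
Proof.
rewrite /mass_ratio /digits_below.
have -> : b.*2%:R / 2 = b%:Z%:~R :> R by rewrite -muln2 natrM mulfK.
congr (ln (#|` fset_set _|%:R) / _).
apply/seteqP; split=> k [Sk /=]; rewrite -rmorphN !ltr_int => /andP[k1 k2].
  by split => //=; rewrite S0.
by split => //=; rewrite k2 andbT; move: k1 k2; lia.
Qed.

Lemma mass_ratio_ge0 n : 0 <= mass_ratio R S n.
Proof.
have lnn (m : nat) : 0 <= ln (m%:R : R).
  by case: m => [|m]; [rewrite ln0|rewrite ln_ge0// ler1n].
by rewrite divr_ge0.
Qed.

Lemma mass_dim_ge0 : 0 <= d.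
Proof. by apply: limr_ge => //; near=> n; exact: mass_ratio_ge0.
Unshelve. all: by end_near. Qed.

Lemma mass_dim_gt_card t : 0 < t -> t < d -> \forall b \near \oo,
  t * ln b%:Z%:~R <= ln (#|` digits_below S (b%:Z - 1)|%:R : R).
Proof.
move=> t0 td; have [N _ HN] := cvgr_gt _ Sdim _ td.
(* The bound being a successor [b.+1], the digits below [b] are counted by the ratio at [b.*2], and
   [b.+1 <= b.*2] gives the logarithm wanted. *)
exists N.+2 => // -[//|b] /= Nb; have -> : b.+1%:Z - 1 = b%:Z by lia.
have b2 : 1 < b.*2%:R :> R by rewrite ltr1n; lia.
have : mass_ratio R S b.*2 > t by apply: HN => /=; lia.
rewrite mass_ratio_double ltr_pdivlMr ?ln_gt0// => /ltW; apply: le_trans.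
by rewrite ler_pM2l// ler_ln ?posrE ?ltr0n ?ler_nat; lia.
Qed.

Lemma mass_dim_lt_card t : d < t ->
  \forall b \near \oo, ln (#|` digits_below S b%:Z|%:R : R) <= t * ln b%:Z%:~R.
Proof.
move=> dt; pose u := (d + t) / 2; have [du ut] : d < u /\ u < t by rewrite /u; lra.
have [N _ HN] := cvgr_lt _ Sdim _ du.
(* From [c] on, the gap [t - u] absorbs the term [u * ln 2] that comes from
   [ln b.*2 = ln 2 + ln b]. *)
pose c := expR (u * ln 2 / (t - u)).
near=> b; rewrite -[b%:Z%:~R]/(b%:R).
have bN : (N < b)%N by near: b; exact: nbhs_infty_gt.
have bc : c <= b%:R by near: b; exact: nbhs_infty_ger.
have b0 : 0 < b%:R :> R by rewrite ltr0n; lia.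
have := HN b.*2; rewrite /= mass_ratio_double ltr_pdivrMr; last first.
  by rewrite ln_gt0// ltr1n; lia.
move=> /(_ _)/ltW; have -> : ln b.*2%:R = ln 2 + ln b%:R :> R.
  by rewrite -muln2 natrM mulrC lnM// posrE.
move=> H; apply: le_trans (H _) _; first by lia.
have : u * ln 2 / (t - u) <= ln b%:R.
  by rewrite -[leLHS]expRK ler_ln// posrE expR_gt0.
by rewrite ler_pdivrMr; lra.
Unshelve. all: by end_near. Qed.

End Counting.

(** * Covers by Cantor cylinders *)

Section UpperBound.
Context {R : realType}.
Variables (q : nat -> int) (S : set int).
Hypothesis qb : basic_sequence q.
Hypothesis qoo : infinite_in_limit R q.
Local Notation psum := (cantor_partial_sum R).
Local Notation P := (base_prod R q).

Lemma near_base (p : set int) : (\forall b \near \oo, p (Posz b)) ->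
  \forall n \near \oo, p (q n).
Proof.
move=> [N _ Np]; have /cvgryPge/(_ N%:R) := qoo; apply: filterS => n.
rewrite -[N%:R]/(N%:Z%:~R) ler_int => Nq.
have <- : Posz `|q n|%N = q n by lia.
by apply: Np => /=; lia.
Qed.

Lemma base_prod_pow2 n : 2 ^+ n <= P n.
Proof.
elim: n => [|n IH]; first by rewrite base_prod0 expr0.
by rewrite exprSr base_prodS ler_pM// ?exprn_ge0// basic_ge2.
Qed.

Lemma base_prodV_powR_small u C eps : 0 < u -> 0 < C -> 0 < eps ->
  \forall n \near \oo, C * (P n)^-1 `^ u <= eps.
Proof.
(* [M] solves [M ^ u = C / eps]; it is exceeded by [2 ^ n], hence by [P n], for large [n]. *)
move=> u0 C0 e0; pose M := (C / eps) `^ u^-1.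
have P0 n := base_prod_gt0 n qb (R := R).
exists (Num.Def.archi_bound M) => // n /= Mn.
have MP : M <= P n by apply/ltW/(lt_le_trans (upper_nthrootP Mn))/base_prod_pow2.
rewrite powRV ?(ltW (P0 n))// ler_pdivrMr ?powR_gt0//.
rewrite mulrC -ler_pdivrMr//.
have -> : C / eps = M `^ u.
  by rewrite /M -powRrM mulVf ?gt_eqF// powRr1// divr_ge0// ltW.
by apply: (ge0_ler_powR (ltW u0)); rewrite // nnegrE ?powR_ge0 ?(ltW (P0 n)).
Qed.

(** Left endpoints of the cylinders of rank [n] with integer part [m] and digits in [S]. Repetitions
    are harmless, as the size serves only as an upper bound. *)
Fixpoint cantor_endpoints (m : int) (n : nat) : seq R :=
  if n is k.+1 then
    [seq x + a%:~R / P k.+1 | x <- cantor_endpoints m k,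
                              a <- digits_below S (q k.+1)]
  else [:: m%:~R].

Lemma cantor_endpointsP E n : digits_in_range q E ->
  (forall i, (1 <= i)%N -> S (E i)) -> psum q E n \in cantor_endpoints (E 0%N) n.
Proof.
move=> Er SE; elim: n => [|n IH].
  by rewrite cantor_partial_sum0 mem_seq1.
rewrite cantor_partial_sumS /=.
apply: (allpairs_f (fun x (a : int) => x + a%:~R / P n.+1)) => //.
apply/digits_belowP; split; first exact: SE.
by have := Er n.+1 isT; lia.
Qed.

Lemma size_cantor_endpointsS m n : size (cantor_endpoints m n.+1) =
  (size (cantor_endpoints m n) * #|` digits_below S (q n.+1)|)%N.
Proof. by rewrite size_allpairs. Qed.

Hypothesis S0 : forall s, S s -> 0 <= s.
Hypothesis Sdim : mass_dim_exists R S.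

Lemma size_cantor_endpoints_le m t : mass_dim R S < t ->
  exists2 C : R, 0 < C &
  \forall n \near \oo, (size (cantor_endpoints m n))%:R <= C * P n `^ t.
Proof.
move=> dt; have [N _ HN] := near_base
  (p := [set b | ln (#|` digits_below S b|%:R : R) <= t * ln b%:~R])
  (mass_dim_lt_card S0 Sdim dt).
have P0 n := base_prod_gt0 n qb (R := R).
have Pt0 n : 0 < P n `^ t by rewrite powR_gt0.
(* The quotient pays for the first [N] digits, after which each digit multiplies the size by at most
   [q n ^ t]; adding 1 makes the constant positive even if the list is empty. *)
exists ((size (cantor_endpoints m N))%:R / P N `^ t + 1).
  by rewrite ltr_pwDr// divr_ge0// ltW.
exists N => // n /= /subnK <-; elim: (n - N)%N => [|k IH].
  by rewrite add0n mulrDl divfK ?gt_eqF// mul1r lerDl ltW.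
rewrite addSn size_cantor_endpointsS base_prodS natrM (powRM _ (ltW (P0 _))); last first.
  by rewrite ltW// (lt_le_trans _ (basic_ge2 _ qb)).
rewrite mulrA ler_pM//; have := HN (k + N).+1 (leqW (leq_addl _ _)); rewrite /=.
have [->|c0] := posnP #|` digits_below S (q (k + N).+1)|.
  by rewrite powR_ge0.
by rewrite -ln_powR ler_ln// posrE ?ltr0n// powR_gt0// (lt_le_trans _ (basic_ge2 _ qb)).
Qed.

Lemma prescribed_digits_expansion (x : R) : S !=set0 -> prescribed_digits q S x ->
  exists2 E, cantor_expansion q x E & forall n, (1 <= n)%N -> S (E n).
Proof.
move=> [s Ss] Wx; have : cantor_digits q x s by rewrite Wx.
move=> [E [n [xE _ _]]]; exists E => // k k1.
by rewrite -Wx; exists E, k.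
Qed.

Lemma hausdorff_measure_prescribed_digits_eq0 s : S !=set0 ->
  mass_dim R S < s -> hausdorff_measure s (prescribed_digits q S : set R) = 0%E.
Proof.
move=> Sn0 ds; have s0 : 0 <= s := ltW (le_lt_trans (mass_dim_ge0 Sdim) ds).
(* The set is cut by integer part, numbered through [pickle], because the cylinders of a given rank
   are finitely many only within one piece. *)
pose A i := [set x : R | prescribed_digits q S x /\ exists E,
  [/\ cantor_expansion q x E, forall n, (1 <= n)%N -> S (E n) &
      choice.pickle (E 0%N) = i]].
have -> : (prescribed_digits q S : set R) = \bigcup_i A i.
  apply/seteqP; split=> [x Wx|x [i _ []//]].
  have [E xE SE] := prescribed_digits_expansion Sn0 Wx.
  by exists (choice.pickle (E 0%N)) => //; split=> //; exists E.
apply: hausdorff_measure_eq0 => // i delta eps delta0 eps0.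
(* With [t] strictly between, [C * P n ^ t] intervals of length [(P n)^-1] have weight at most
   [C * (P n)^-1 ^ (s - t)], which tends to 0. *)
pose t := (mass_dim R S + s) / 2.
have [dt ts] : mass_dim R S < t /\ t < s by rewrite /t; lra.
pose m := odflt 0 (choice.unpickle i : option int).
have [C C0 HC] := size_cantor_endpoints_le m dt.
near \oo => n.
exists (size (cantor_endpoints m n)).
exists (fun j => [set x | nth 0 (cantor_endpoints m n) j <= x
                          <= nth 0 (cantor_endpoints m n) j + (P n)^-1]).
exists (P n)^-1; have P0 := base_prod_gt0 n qb (R := R).
have Pi0 : 0 <= (P n)^-1 by rewrite invr_ge0 ltW.
split.
- rewrite Pi0/= -[leLHS]powRr1// -[leLHS]mul1r.
  by near: n; exact: base_prodV_powR_small.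
- move=> j; apply: diam_le => // x y /= /andP[x1 x2] /andP[y1 y2].
  by rewrite ler_norml; apply/andP; split; lra.
- move=> x [_ [E [xE SE Ei]]].
  have Er := cantor_expansion_range xE.
  have mE : m = E 0%N by rewrite /m -Ei choice.pickleK.
  have xin := cantor_endpointsP n Er SE; rewrite -mE in xin.
  exists (index (psum q E n) (cantor_endpoints m n)) => /=.
    by rewrite index_mem.
  rewrite nth_index// (cantor_sum_ge qb Er (cantor_sum xE))/=.
  exact: (cantor_sum_le qb Er (cantor_sum xE)).
- apply: (@le_trans _ _ (C * P n `^ t * (P n)^-1 `^ s)).
    by rewrite ler_wpM2r ?powR_ge0//; near: n.
  have -> : C * P n `^ t * (P n)^-1 `^ s = C * (P n)^-1 `^ (s - t).
    rewrite !(powRV _ (ltW P0)) -!powRN -mulrA -powRD ?opprB//.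
    by apply/implyP => _; rewrite gt_eqF.
  near: n; apply: base_prodV_powR_small => //; lra.
Unshelve. all: by end_near. Qed.

End UpperBound.

(** * Coding the unit interval by Cantor series *)

Lemma truncn_mulrn_div (R : archiRealFieldType) (n : nat) (x : R) :
  (0 < n)%N -> 0 <= x -> (Num.trunc (n%:R * x) %/ n)%N = Num.trunc x.
Proof.
move=> n0 x0; have nR : 0 < n%:R :> R by rewrite ltr0n.
have nx0 : 0 <= n%:R * x by rewrite mulr_ge0// ltW.
apply/esym/truncn_def.
have /andP[k1 k2] := truncn_itv nx0; set k := Num.trunc _ in k1 k2 *.
apply/andP; split; rewrite -(ler_pM2l nR, ltr_pM2l nR) -natrM.
  by apply: le_trans k1; rewrite ler_nat mulnC leq_divM.
by apply: (lt_le_trans k2); rewrite ler_nat mulnC; exact: ltn_ceil.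
Qed.

Section CantorCoding.
Context {R : realType}.
Variables (q : nat -> int) (A : nat -> seq int) (K : nat).
Hypothesis qb : basic_sequence q.
Hypothesis A_range : forall n a, (1 <= n)%N -> a \in A n -> 0 <= a <= q n - 1.
Hypothesis A_gt0 : forall n, (0 < size (A n))%N.
Hypothesis A_uniq : forall n, uniq (A n).
Hypothesis A_lt : forall n a, (K < n)%N -> a \in A n -> a <= q n - 2.
Hypothesis A_one : forall n, (n <= K)%N -> size (A n) = 1%N.
Local Notation psum := (cantor_partial_sum R).
Local Notation P := (base_prod R q).
Implicit Types t u : R.

Definition code_prod (n : nat) : nat := \prod_(1 <= i < n.+1) size (A i).

(** For [t] in [[0, 1[], the index of the interval of length [(code_prod n)^-1] that contains [t];
    its remainder modulo [size (A n)] is the mixed-base digit of [t] at [n]. *)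
Definition code_rank t n := Num.trunc ((code_prod n)%:R * t).

Definition code_digit t n : int :=
  if n is 0%N then 0 else nth 0 (A n) (code_rank t n %% size (A n))%N.

Definition code_point t : R := limn (psum q (code_digit t)).

Lemma code_prodS n : code_prod n.+1 = (code_prod n * size (A n.+1))%N.
Proof. by rewrite /code_prod big_nat_recr. Qed.

Lemma code_prod_gt0 n : (0 < code_prod n)%N.
Proof.
elim: n => [|n IH]; first by rewrite /code_prod big_geq.
by rewrite code_prodS muln_gt0 IH A_gt0.
Qed.

Lemma code_digit_in t n : code_digit t n.+1 \in A n.+1.
Proof. by rewrite mem_nth// ltn_pmod// A_gt0. Qed.

Lemma code_digit_range t : digits_in_range q (code_digit t).
Proof. by case=> // n _; exact/A_range/code_digit_in. Qed.

Lemma code_digit_nonmax t n : (K < n)%N -> code_digit t n != q n - 1.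
Proof.
case: n => // n Kn; have := A_lt Kn (code_digit_in t n).
by move=> H; apply/eqP => H1; move: H; rewrite H1; lia.
Qed.

Lemma code_point_expansion t : cantor_expansion q (code_point t) (code_digit t).
Proof.
apply: cantor_expansion_limn => //; first exact: code_digit_range.
move=> N; exists (maxn K N).+1; first by rewrite ltnS leq_maxr.
by rewrite code_digit_nonmax// ltnS leq_maxl.
Qed.

Lemma code_point_itv t : 0 <= code_point t <= 1.
Proof.
have Er := code_digit_range t; have Et := cantor_sum (code_point_expansion t).
have := cantor_sum_ge qb Er Et 0; have := cantor_sum_le qb Er Et 0.
by rewrite cantor_partial_sum0 base_prod0 invr1 add0r => -> ->.
Qed.

Lemma code_rankS t n : 0 <= t ->
  (code_rank t n.+1 %/ size (A n.+1))%N = code_rank t n.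
Proof.
move=> t0; rewrite /code_rank code_prodS natrM mulrC mulrA [t * _]mulrC mulrC.
by rewrite truncn_mulrn_div// ?A_gt0// mulr_ge0.
Qed.

(** A rank is rebuilt from its quotient, the previous rank by [code_rankS], and its remainder, which
    the digit determines because [A n] has no repetition. *)
Lemma eq_code_rank t u n : 0 <= t < 1 -> 0 <= u < 1 ->
  (forall i, (i <= n)%N -> code_digit t i = code_digit u i) ->
  code_rank t n = code_rank u n.
Proof.
move=> t01 u01; elim: n => [_|n IH tu].
  rewrite /code_rank /code_prod big_geq// !mul1r.
  by rewrite (@truncn_def _ t 0) ?(@truncn_def _ u 0).
have {}IH : code_rank t n = code_rank u n by apply: IH => i /leqW; exact: tu.
have /eqP := tu n.+1 (leqnn _); rewrite nth_uniq ?ltn_pmod// => /eqP tun.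
have [/andP[t0 _] /andP[u0 _]] := (t01, u01).
rewrite (divn_eq (code_rank t n.+1) (size (A n.+1))) tun code_rankS// IH.
by rewrite -(code_rankS _ u0) -divn_eq.
Qed.

Lemma eq_code_digit_dist t u n : 0 <= t < 1 -> 0 <= u < 1 ->
  (forall i, (i <= n)%N -> code_digit t i = code_digit u i) ->
  `|t - u| <= (code_prod n)%:R^-1.
Proof.
move=> t01 u01 /(eq_code_rank t01 u01); rewrite /code_rank.
have M0 : 0 < (code_prod n)%:R :> R by rewrite ltr0n code_prod_gt0.
have [/andP[t0 _] /andP[u0 _]] := (t01, u01).
have /andP[] := truncn_itv (mulr_ge0 (ltW M0) t0).
have /andP[] := truncn_itv (mulr_ge0 (ltW M0) u0).
move=> u1 u2 t1 t2 tu; rewrite tu -!natr1 in t1 t2 u1 u2.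
rewrite -[leRHS]mul1r ler_pdivlMr// -[X in _ * X]gtr0_norm// -normrM.
by rewrite mulrBl ler_norml mulrC [u * _]mulrC; apply/andP; split; lra.
Qed.

Lemma code_digit_le_K t u n : (n <= K)%N -> code_digit t n = code_digit u n.
Proof.
case: n => // n /A_one Kn /=.
by rewrite Kn !modn1.
Qed.

(** Up to [K] there is no choice of digit, so [n] lies beyond [K]; then the digits at [n.+1] are
    non-maximal and [cantor_separation] applies with [m = n.+1]. *)
Lemma code_point_dist t u n :
  (forall i, (i < n)%N -> code_digit t i = code_digit u i) ->
  code_digit t n != code_digit u n ->
  (P n.+1)^-1 <= `|code_point t - code_point u|.
Proof.
move=> tu tun; have Kn : (K < n)%N.
  by rewrite ltnNge; apply: contra tun => Kn; rewrite (code_digit_le_K t u Kn).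
wlog lt : t u tu tun / code_digit u n < code_digit t n.
  move=> H; move: (tun); rewrite neq_lt => /orP[ltn|]; last exact: H.
  rewrite distrC; apply: H => //; last by rewrite eq_sym.
  by move=> i /tu.
apply: le_trans (ler_norm _).
apply: (@cantor_separation _ q (code_digit t) (code_digit u) _ _ n n.+1) => //.
- exact: code_digit_range.
- exact: code_digit_range.
- exact: cantor_sum (code_point_expansion t).
- exact: cantor_sum (code_point_expansion u).
- by apply: code_digit_nonmax; rewrite ltnS ltnW.
Qed.

(** If the codes first differ at [n.+1], then [t] and [u] are within [(code_prod n)^-1], while their
    images are at least [(P n.+2)^-1] apart; hence the shift by two in the assumption. *)
Lemma code_point_hoelder s C t u : 0 < s -> 0 < C ->
  (forall n, (K <= n)%N -> (code_prod n)%:R^-1 <= C * (P n.+2)^-1 `^ s) ->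
  0 <= t < 1 -> 0 <= u < 1 ->
  `|t - u| <= C * `|code_point t - code_point u| `^ s.
Proof.
move=> s0 C0 MP t01 u01.
have [tu|] := pselect (forall n, code_digit t n = code_digit u n).
  suff tu0 : `|t - u| <= 0 by rewrite (le_trans tu0)// mulr_ge0 ?powR_ge0 ?ltW.
  apply/ler_addgt0Pr => e e0; rewrite add0r.
  have [N _ HN] := base_prodV_powR_small qb s0 C0 e0.
  near \oo => n.
  apply: (@le_trans _ _ (code_prod n)%:R^-1); first exact: eq_code_digit_dist.
  apply: (le_trans (MP _ _)); first by near: n; exact: nbhs_infty_ge.
  apply: HN => /=; apply/leqW/leqW; near: n; exact: nbhs_infty_ge.
move=> /existsNP[m /eqP tum].
have /ex_minnP[n tun nmin] : exists i, code_digit t i != code_digit u i by exists m.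
have {nmin}tu k : (k < n)%N -> code_digit t k = code_digit u k.
  by rewrite ltnNge => kn; apply/eqP; apply: contraNT kn => /nmin.
have Kn : (K < n)%N.
  by rewrite ltnNge; apply: contra tun => Kn; rewrite (code_digit_le_K t u Kn).
case: n => [//|n] in tun tu Kn *.
apply: (@le_trans _ _ (code_prod n)%:R^-1).
  by apply: eq_code_digit_dist => // i; rewrite -ltnS => /tu.
apply: (le_trans (MP _ Kn)); rewrite ler_pM2l//.
apply: (ge0_ler_powR (ltW s0)); rewrite ?nnegrE//.
  by rewrite invr_ge0 ltW// base_prod_gt0.
exact: code_point_dist.
Unshelve. all: by end_near. Qed.

End CantorCoding.

(** * The lower bound *)

Section GreedyForcing.
Context {R : realType}.
Variables (q : nat -> int) (S : set int) (minS : int).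
Hypothesis qb : basic_sequence q.
Hypothesis qoo : infinite_in_limit R q.
Hypothesis q_growth :
  ln ((q n)%:~R : R) / (\sum_(1 <= i < n.+1) ln ((q i)%:~R : R))
    @[n --> \oo] --> (0 : R).
Hypothesis S0 : forall s, S s -> 0 <= s.
Hypothesis SminS : S minS.
Hypothesis minS_lt : forall n, (1 <= n)%N -> minS < q n.
Local Notation P := (base_prod R q).

Definition log_base (n : nat) : R := \sum_(1 <= i < n.+1) ln (q i)%:~R.

(** An enumeration of [S] with repetitions; the default [minS] keeps all its values in [S]. *)
Definition enum_digits (j : nat) : int :=
  if choice.unpickle j is Some s then if `[< S s >] then s else minS else minS.

(* The state counts the digits forced so far and adds up [ln (q i)] over the
   positions i they occupy; keeping this sum below [eps * log_base n] makes
   these positions negligible for the dimension. *)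
Definition forced (K : nat) (eps : R) (n : nat) (st : nat * R) : bool :=
  [&& (K < n)%N, enum_digits st.1 <= q n - 2 &
      st.2 + ln (q n)%:~R <= eps * log_base n].

Fixpoint greedy (K : nat) (eps : R) (n : nat) : nat * R :=
  if n is k.+1 then
    let st := greedy K eps k in
    if forced K eps n st then (st.1.+1, st.2 + ln (q n)%:~R) else st
  else (0%N, 0).

(** Up to [K] the single digit [minS] is available because it is below every [q n]; afterwards the
    value [q n - 1] is left out, so that expansions are admissible. *)
Definition allowed_digits (K : nat) (eps : R) (n : nat) : seq int :=
  if (n <= K)%N then [:: minS]
  else if forced K eps n (greedy K eps n.-1)
  then [:: enum_digits (greedy K eps n.-1).1]
  else digits_below S (q n - 1).

Lemma enum_digits_in j : S (enum_digits j).
Proof. by rewrite /enum_digits; case: choice.unpickle => // s; case: asboolP. Qed.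

Lemma enum_digits_surj s : S s -> exists j, enum_digits j = s.
Proof.
by move=> Ss; exists (choice.pickle s); rewrite /enum_digits choice.pickleK asboolT.
Qed.

Lemma log_baseS n : log_base n.+1 = log_base n + ln (q n.+1)%:~R.
Proof. by rewrite /log_base big_nat_recr. Qed.

Lemma ln_basic_gt0 n : 0 < ln ((q n.+1)%:~R : R).
Proof. by rewrite ln_gt0// (lt_le_trans _ (basic_ge2 n qb))// ltr1n. Qed.

Lemma ln_base_prod n : ln (P n) = log_base n.
Proof.
elim: n => [|n IH]; first by rewrite base_prod0 ln1 /log_base big_geq.
rewrite base_prodS log_baseS -IH lnM// posrE ?base_prod_gt0//.
by rewrite (lt_le_trans _ (basic_ge2 n qb)).
Qed.

Lemma log_base_gt0 n : 0 < log_base n.+1.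
Proof.
elim: n => [|n IH]; rewrite log_baseS; last by rewrite addr_gt0// ln_basic_gt0.
by rewrite [log_base 0]/log_base big_geq// add0r ln_basic_gt0.
Qed.

Lemma log_base_ge C : \forall n \near \oo, C <= log_base n.
Proof.
have [N _ HN] := base_prodV_powR_small qb (@ltr01 R) (expR_gt0 C) ltr01.
exists N => // n /HN; have P0 := base_prod_gt0 n qb (R := R).
rewrite /= powRr1 ?invr_ge0 ?(ltW P0)// ler_pdivrMr// mul1r -ln_base_prod => CP.
by rewrite -[C]expRK ler_ln// posrE expR_gt0.
Qed.

Lemma near_ln_base_le eps : 0 < eps ->
  \forall n \near \oo, ln (q n)%:~R <= eps * log_base n.
Proof.
move=> e0; have [N _ HN] := cvgr_lt _ q_growth _ e0.
exists N.+1 => // -[//|n] /= Nn; have := HN n.+1 (ltnW Nn).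
by rewrite /= ltr_pdivrMr ?log_base_gt0// => /ltW.
Qed.

Lemma near_base_ge (b : int) : \forall n \near \oo, b <= q n.
Proof.
by have /cvgryPge/(_ b%:~R) := qoo; apply: filterS => n; rewrite ler_int.
Qed.

(** * Properties of the greedy digit sets *)

Section Greedy.
Variables (K : nat) (eps : R).
Local Notation A := (allowed_digits K eps).
Local Notation st := (greedy K eps).

Lemma allowed_digits_sub n a : a \in A n -> S a.
Proof.
rewrite /allowed_digits; case: ifP => _; first by rewrite inE => /eqP ->.
case: ifP => _; first by rewrite inE => /eqP ->; exact: enum_digits_in.
by move=> /digits_belowP[].
Qed.

Lemma allowed_digits_lt n a : (K < n)%N -> a \in A n -> a <= q n - 2.
Proof.
move=> Kn; rewrite /allowed_digits leqNgt Kn/=; case: ifP => [/and3P[_ H _]|_].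
  by rewrite inE => /eqP ->.
by move=> /digits_belowP[_]; lia.
Qed.

Lemma allowed_digits_range n a : (1 <= n)%N -> a \in A n -> 0 <= a <= q n - 1.
Proof.
move=> n1 aA; rewrite S0/=; last exact: allowed_digits_sub aA.
have [nK|Kn] := leqP n K; last by have := allowed_digits_lt Kn aA; lia.
move: aA; rewrite /allowed_digits nK inE => /eqP ->.
by have := minS_lt n1; lia.
Qed.

Lemma allowed_digits_uniq n : uniq (A n).
Proof.
rewrite /allowed_digits; case: ifP => // _; case: ifP => // _.
exact: fset_uniq.
Qed.

Lemma allowed_digits_one n : (n <= K)%N -> size (A n) = 1%N.
Proof. by rewrite /allowed_digits => ->. Qed.

Hypothesis K_minS : forall n, (K < n)%N -> minS <= q n - 2.

Lemma allowed_digits_gt0 n : (0 < size (A n))%N.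
Proof.
rewrite /allowed_digits; case: ifPn => //; rewrite -ltnNge => Kn.
case: ifP => // _; have : minS \in digits_below S (q n - 1).
  by apply/digits_belowP; split => //; rewrite S0//=; have := K_minS Kn; lia.
by rewrite -[_ \in _]/(minS \in (digits_below S (q n - 1) : seq int)); case: enum_fset.
Qed.

Hypothesis eps0 : 0 < eps.

Lemma greedy_le n : (st n).2 <= eps * log_base n.
Proof.
elim: n => [|n IH]; first by rewrite /log_base big_geq// mulr0.
rewrite /=; case: ifP => [/and3P[]//|_].
by rewrite (le_trans IH)// ler_pM2l// log_baseS lerDl ltW// ln_basic_gt0.
Qed.

Lemma greedy_before_K n : (n <= K)%N -> st n = (0%N, 0).
Proof.
elim: n => // n IH nK /=; rewrite /forced ltnNge nK/=.
by apply: IH; exact: ltnW.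
Qed.

(** For a fixed state, one half of [eps * log_base n] eventually pays for the accumulated sum, as
    [log_base] is unbounded, and the other half for [ln (q n)], by the growth condition. *)
Lemma near_forced s : \forall n \near \oo, forced K eps n s.
Proof.
have e2 : 0 < eps / 2 by rewrite divr_gt0.
near=> n; apply/and3P; split.
- by near: n; exact: nbhs_infty_gt.
- by rewrite lerBrDr; near: n; exact: near_base_ge.
- have -> : eps * log_base n = eps / 2 * log_base n + eps / 2 * log_base n.
    by rewrite -mulrDl -splitr.
  apply: lerD; last by near: n; exact: near_ln_base_le.
  by rewrite mulrC -ler_pdivrMr//; near: n; exact: log_base_ge.
Unshelve. all: by end_near. Qed.

Lemma next_forced n0 :
  exists n, [/\ (n0 <= n)%N, forced K eps n.+1 (st n) & st n = st n0].
Proof.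
have [N _ HN] := near_forced (st n0).
have : exists n, (n0 <= n)%N && forced K eps n.+1 (st n0).
  by exists (maxn n0 N); rewrite leq_maxl; apply: HN => /=; rewrite leqW// leq_maxr.
move=> /ex_minnP[n /andP[n0n Fn] nmin].
have sub m : (n0 <= m <= n)%N -> st m = st n0.
  elim: m => [|m IH]; first by rewrite leqn0 => /andP[/eqP->].
  rewrite leq_eqVlt => /andP[/orP[/eqP->//|]]; rewrite ltnS => n0m mn /=.
  rewrite IH ?n0m ?(ltnW mn)//; case: ifP => // Fm.
  by have := nmin m; rewrite n0m Fm => /(_ isT); rewrite leqNgt mn.
by have stn := sub n; exists n; rewrite stn ?n0n// leqnn.
Qed.

Lemma forced_surj j : exists n, forced K eps n.+1 (st n) /\ (st n).1 = j.
Proof.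
suff [n0 <-] : exists n, (st n).1 = j.
  by have [n [_ Fn stn]] := next_forced n0; exists n; rewrite Fn stn.
elim: j => [|j [n0 IH]]; first by exists 0%N.
have [n [_ Fn stn]] := next_forced n0.
by exists n.+1; rewrite /= Fn/= stn IH.
Qed.

Lemma code_point_prescribed t : prescribed_digits q S (code_point q A t : R).
Proof.
have xE := code_point_expansion qb allowed_digits_range allowed_digits_gt0
  allowed_digits_lt t.
have inA := code_digit_in allowed_digits_gt0 t.
apply/seteqP; split=> [_ [F [n [xF n1 <-]]]|s /enum_digits_surj[j <-]].
  rewrite (cantor_expansion_unique qb xF xE).
  by case: n n1 => // n _; exact: (allowed_digits_sub (inA n)).
have [n [Fn <-]] := forced_surj j.
exists (code_digit A t), n.+1; split => //.
have := inA n; rewrite {2}/allowed_digits/= Fn leqNgt.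
by have /and3P[-> _ _] := Fn; rewrite inE => /eqP.
Qed.

Variable t : R.
Hypothesis t0 : 0 < t.
Hypothesis K_card : forall n, (K < n)%N ->
  t * ln (q n)%:~R <= ln (#|` digits_below S (q n - 1)|%:R : R).

(** Free positions beyond [K] contribute at least [t * ln (q i)]; the one-element sets contribute 0,
    and the subtracted terms account for them. *)
Lemma ln_code_prod_ge n : (K <= n)%N ->
  t * (log_base n - log_base K - (st n).2) <= ln (code_prod A n)%:R.
Proof.
move=> /subnK <-; elim: (n - K)%N => [|k IH].
  rewrite add0n greedy_before_K// subrr subr0 mulr0 ln_ge0// ler1n.
  exact/code_prod_gt0/allowed_digits_gt0.
rewrite addSn code_prodS natrM lnM ?posrE ?ltr0n ?allowed_digits_gt0//; last first.
  exact/code_prod_gt0/allowed_digits_gt0.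
have Kk : (K < (k + K).+1)%N by rewrite ltnS leq_addl.
rewrite log_baseS /= {2}/allowed_digits /= leqNgt Kk/=.
case: ifP => _ /=; rewrite ?ln1; last by have := K_card Kk; lra.
by move: IH; congr (_ <= _); [congr (t * _); lra|rewrite addr0].
Qed.

Hypothesis K_ln : forall n, (K < n)%N -> ln (q n)%:~R <= eps * log_base n.
Hypothesis eps1 : eps < 1.

(** One factor [1 - eps] pays for the forced positions and two for the passage from [n] to [n.+2];
    the constant pays for the first [K] positions. *)
Lemma code_prod_ge s n : s <= t * (1 - eps) ^+ 3 -> (K <= n)%N ->
  (code_prod A n)%:R^-1 <= expR (t * log_base K) * (P n.+2)^-1 `^ s.
Proof.
move=> st3 Kn; have M0 : 0 < (code_prod A n)%:R :> R.
  by rewrite ltr0n; exact/code_prod_gt0/allowed_digits_gt0.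
have P0 := base_prod_gt0 n.+2 qb (R := R).
rewrite powRV ?(ltW P0)// ler_pdivlMr ?powR_gt0// ler_pdivrMl//.
rewrite -[X in _ <= X * _]lnK ?posrE// -expRD.
rewrite -[leLHS]lnK ?posrE ?powR_gt0// ler_expR ln_powR ln_base_prod.
have L1 : (1 - eps) * log_base n.+1 <= log_base n.
  by have := @K_ln n.+1 Kn; rewrite log_baseS; lra.
have L2 : (1 - eps) * log_base n.+2 <= log_base n.+1.
  by have := @K_ln n.+2 (leqW Kn); rewrite log_baseS; lra.
have := ln_code_prod_ge Kn; have := greedy_le n.
set Ln := log_base n; set L2n := log_base n.+2; set l := ln _ => ge1 ge2.
have e1 : 0 < 1 - eps by rewrite subr_gt0.
have sL : s * L2n <= t * (1 - eps) ^+ 3 * L2n.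
  by rewrite ler_wpM2r// ltW// log_base_gt0.
have LL : (1 - eps) ^+ 2 * L2n <= Ln.
  apply: le_trans L1; rewrite expr2 -mulrA ler_pM2l//.
have tL : t * ((1 - eps) * ((1 - eps) ^+ 2 * L2n)) <= t * ((1 - eps) * Ln).
  by rewrite !ler_pM2l.
have tg : t * (st n).2 <= t * (eps * Ln) by rewrite ler_pM2l.
apply: (le_trans sL); rewrite exprS.
move: tL ge2 tg; rewrite -!mulrA; lra.
Qed.

End Greedy.

(** * Non-zero measure below the mass dimension *)

Hypothesis Sdim : mass_dim_exists R S.

Lemma hausdorff_measure_prescribed_digits_neq0 s : 0 <= s -> s < mass_dim R S ->
  hausdorff_measure s (prescribed_digits q S : set R) != 0%E.
Proof.
move=> s0 sd.
(* The exponent [s'] is positive even if [s = 0], as the Hoelder bound requires; [t > s'] leaves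
   room for the loss [(1 - eps) ^+ 3]. *)
have [s' [ss' s'd]] : exists r, s < r /\ r < mass_dim R S.
  by exists ((s + mass_dim R S) / 2); lra.
have [t [s't td]] : exists r, s' < r /\ r < mass_dim R S.
  by exists ((s' + mass_dim R S) / 2); lra.
have s'0 : 0 < s' by lra.
have t0 : 0 < t by lra.
(* Chosen so that [s' / t = 1 - 3 * eps], which is at most [(1 - eps) ^+ 3]: the difference is
   [eps ^+ 2 * (3 - eps)]. *)
pose eps := (1 - s' / t) / 3.
have s't1 : s' / t < 1 by rewrite ltr_pdivrMr// mul1r.
have s't0 : 0 < s' / t by rewrite divr_gt0.
have eps0 : 0 < eps by rewrite /eps; lra.
have eps1 : eps < 1 by rewrite /eps; lra.
have s'eps : s' <= t * (1 - eps) ^+ 3.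
  rewrite mulrC -ler_pdivrMr//; have -> : s' / t = 1 - 3 * eps by rewrite /eps; lra.
  have : 0 <= eps ^+ 2 * (3 - eps) by rewrite mulr_ge0 ?sqr_ge0//; lra.
  by rewrite !exprS expr0; lra.
have [K _ HK] : \forall n \near \oo, [/\ minS + 2 <= q n,
    t * ln (q n)%:~R <= ln (#|` digits_below S (q n - 1)|%:R : R) &
    ln (q n)%:~R <= eps * log_base n].
  near=> n; split; near: n; [exact: near_base_ge| |exact: near_ln_base_le].
  apply: (near_base qoo (p := [set b | t * ln b%:~R <=
    ln (#|` digits_below S (b - 1)|%:R : R)])).
  exact: mass_dim_gt_card.
have K_minS n : (K < n)%N -> minS <= q n - 2.
  by move=> /ltnW/HK[H _ _]; rewrite lerBrDr.
have K_card n : (K < n)%N ->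
    t * ln (q n)%:~R <= ln (#|` digits_below S (q n - 1)|%:R : R).
  by move=> /ltnW/HK[].
have K_ln n : (K < n)%N -> ln (q n)%:~R <= eps * log_base n.
  by move=> /ltnW/HK[].
pose A := allowed_digits K eps.
have A_range := @allowed_digits_range K eps.
have A_gt0 := @allowed_digits_gt0 K eps K_minS.
have A_lt := @allowed_digits_lt K eps.
pose C := expR (t * log_base K).
apply: (@hausdorff_measure_neq0 _ _ _ (code_point q A) C) => //.
- by rewrite expR_ge0.
- by move=> u _; exact: code_point_prescribed.
- move=> u v u01 v01.
  have := code_point_hoelder qb A_range A_gt0 (@allowed_digits_uniq K eps) A_lt
    (@allowed_digits_one K eps) s'0 (expR_gt0 _)
    (fun n => code_prod_ge K_minS eps0 t0 K_card K_ln eps1 s'eps (n := n)) u01 v01.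
  (* Code points lie in [[0, 1]], so their distance is at most 1 and lowering the exponent from [s']
     to [s] only increases the power. Distance 0 is treated apart, since [0 ^ s] is 1 for
     [s = 0]. *)
  move=> /le_trans; apply; rewrite ler_pM2l ?expR_gt0//.
  have := code_point_itv qb A_range A_gt0 A_lt u.
  have := code_point_itv qb A_range A_gt0 A_lt v.
  rewrite -/A; move=> /andP[v0 v1] /andP[u0 u1].
  have [->|d0] := eqVneq `|code_point q A u - code_point q A v| 0.
    by rewrite powR0 ?powR_ge0// gt_eqF.
  apply: ger_powR; last exact: ltW.
  by rewrite lt_neqAle eq_sym d0 normr_ge0/= ler_norml; apply/andP; split; lra.
Unshelve. all: by end_near. Qed.

End GreedyForcing.

Theorem theorem1p7 (R : realType) (q : nat -> int) (S : set int) (minS minq : int)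
  (q_basic : basic_sequence q)
  (q_infinite : infinite_in_limit R q)
  (q_growth : ln ((q n)%:~R : R) / (\sum_(1 <= i < n.+1) ln ((q i)%:~R : R))
                @[n --> \oo] --> (0 : R))
  (S_nonempty : S !=set0)
  (S_nonneg : forall s : int, S s -> 0 <= s)
  (minSP : is_min S minS)
  (minqP : is_min [set q n | n in [set n | (1 <= n)%N]] minq)
  (minS_lt : minS < minq)
  (S_mass_dim : mass_dim_exists R S) :
  hausdorff_dim (prescribed_digits q S : set R) = (mass_dim R S)%:E.
Proof.
have d0 := mass_dim_ge0 S_mass_dim.
have minS_q n : (1 <= n)%N -> minS < q n.
  by move=> n1; apply: (lt_le_trans minS_lt); apply: minqP.2; exists n.
apply/eqP; rewrite eq_le; apply/andP; split.
  apply/lee_addgt0Pr => e e0; apply: ereal_inf_lbound.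
  exists (mass_dim R S + e) => //; split; first by lra.
  by apply: hausdorff_measure_prescribed_digits_eq0 => //; lra.
apply: le_ereal_inf_tmp => _ [s [s0 Hs] <-]; rewrite lee_fin leNgt.
apply/negP => sd; move/eqP: Hs; apply/negP.
exact: (hausdorff_measure_prescribed_digits_neq0 _ _ _ _ minSP.1 minS_q).
Qed.
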